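(* Let $n\ge 3$ be prime. There exist infinitely many polynomials $f(x)\in\mathbb{Z}[x]$ of degree $n$ such that $L_f$ is a generic well-rounded, nearly orthogonal lattice of rank $n$ in $K_{\mathbb{R}}$, where $K$ is the splitting field of $f$, and such that $L_f$ contains a basis consisting of minimal vectors. For example, one can take $f(x)=x^n+a_{n-1}x^{n-1}+a_0$ with integers $a_0,a_{n-1}$ satisfying $$|a_0|>\frac{8(n-1)\,n!}{\sqrt{(n-2)^2+16(n-1)}-(n-2)}\quad\text{and}\quad |a_{n-1}|>|a_0|+1.$$
   Context: For an irreducible $f\in\mathbb{Z}[x]$ of degree $n$ with roots $\alpha_1,\dots,\alpha_n$ and splitting field $K\subset\mathbb{C}$ of degree $d$, identify $\operatorname{Gal}(K/\mathbb{Q})=\{\sigma_1,\dots,\sigma_d\}$ with the embeddings $K\hookrightarrow\mathbb{C}$, let $\Sigma_K=(\sigma_1,\dots,\sigma_d):K\to\mathbb{C}^d$, let $K_{\mathbb{R}}$ be the real span of $\Sigma_K(K)$, equipped with the inner product $\langle\boldsymbol x,\boldsymbol y\rangle=\sum_k x_k\overline{y_k}$ and norm $\|\cdot\|$, and let $L_f=\operatorname{span}_{\mathbb{Z}}\{\Sigma_K(\alpha_1),\dots,\Sigma_K(\alpha_n)\}$. For a lattice $L$ of rank $r$: its minimal vectors are the nonzero vectors of minimal norm, forming the set $S(L)$; $L$ is well-rounded (WR) if $S(L)$ contains $r$ linearly independent vectors; $L$ is generic well-rounded (GWR) if it is WR and $|S(L)|=2r$. An ordered basis $\boldsymbol b_1,\dots,\boldsymbol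 b_r$ of $L$ is weakly nearly orthogonal if, for each $1\le i\le r-1$, the angle between $\boldsymbol b_{i+1}$ and $\operatorname{span}_{\mathbb{R}}\{\boldsymbol b_1,\dots,\boldsymbol b_i\}$ (an angle in $[0,\pi/2]$) is at least $\pi/3$; a basis is nearly orthogonal if every ordering of it is weakly nearly orthogonal; $L$ is nearly orthogonal if it has a nearly orthogonal basis. *)

(* Defs.v *)
From HB Require Import structures.
From mathcomp Require Import all_boot all_order all_algebra all_fingroup all_field.
From mathcomp Require Import all_classical all_reals all_analysis.
From mathcomp Require Import complex.

Set Implicit Arguments.
Unset Strict Implicit.
Unset Printing Implicit Defensive.

Import Order.TTheory GRing.Theory Num.Theory.
Local Open Scope classical_set_scope.
Local Open Scope ring_scope.

Section RealStructure.
Variables (R : realType) (d : nat).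
Notation V := 'rV[R[i]]_d.

(* C^d is regarded as a real vector space through the embedding
   [real_complex R] of R into R[i]. *)
Definition real_span (A : set V) : set V :=
  [set v | exists (m : nat) (a : 'I_m -> R) (w : 'I_m -> V),
     (forall i, A (w i)) /\ v = \sum_(i < m) real_complex R (a i) *: w i].

Definition real_free (r : nat) (b : 'I_r -> V) : Prop :=
  forall a : 'I_r -> R,
    \sum_(i < r) real_complex R (a i) *: b i = 0 -> forall i, a i = 0.

Definition int_span (A : set V) : set V :=
  [set v | exists (m : nat) (a : 'I_m -> int) (w : 'I_m -> V),
     (forall i, A (w i)) /\ v = \sum_(i < m) w i *~ a i].

Definition herm (x y : V) : R[i] := \sum_(k < d) x 0 k * (y 0 k)^*.

(* [herm x x] is always real; [herm x y] is real when x and y lie in K_R, whose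
   coordinates are permuted by complex conjugation, so taking real parts in
   [norm2] and [angle] loses nothing there. *)
Definition norm2 (x : V) : R := Num.sqrt (complex.Re (herm x x)).

Definition angle (x y : V) : R :=
  acos (complex.Re (herm x y) / (norm2 x * norm2 y)).

(* The angle between a vector and a subspace W: the least angle between x and a
   nonzero vector of W.  As W contains w and -w, it lies in [0, pi/2]. *)
Definition angle_subspace (x : V) (W : set V) : R :=
  inf [set angle x w | w in W `\ 0].

Definition lattice_basis (L : set V) (r : nat) (b : 'I_r -> V) : Prop :=
  real_free b /\ L = int_span (range b).

Definition lattice_of_rank (E : set V) (r : nat) (L : set V) : Prop :=
  L `<=` E /\ exists b : 'I_r -> V, lattice_basis L b.

Definition min_vectors (L : set V) : set V :=
  [set x | [/\ L x, x != 0 &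
               forall y, L y -> y != 0 -> norm2 x <= norm2 y]].

(* In the next definitions r is the rank of L. *)
Definition well_rounded (r : nat) (L : set V) : Prop :=
  exists b : 'I_r -> V, (forall i, min_vectors L (b i)) /\ real_free b.

Definition generic_well_rounded (r : nat) (L : set V) : Prop :=
  well_rounded r L /\ (min_vectors L #= `I_(2 * r))%card.

Definition weakly_nearly_orthogonal (r : nat) (b : 'I_r -> V) : Prop :=
  forall k : 'I_r, (0 < k)%N ->
    pi / 3 <=
      angle_subspace (b k) (real_span (b @` [set j : 'I_r | (j < k)%N])).

Definition nearly_orthogonal_basis (r : nat) (b : 'I_r -> V) : Prop :=
  forall s : {perm 'I_r}, weakly_nearly_orthogonal (fun i => b (s i)).

Definition nearly_orthogonal (r : nat) (L : set V) : Prop :=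
  exists b : 'I_r -> V, lattice_basis L b /\ nearly_orthogonal_basis b.

End RealStructure.

(* Irreducible as an element of the ring Z[x] ([irreducible_poly] over int
   ignores the content). *)
Definition Zpoly_irreducible (f : {poly int}) : Prop :=
  [/\ f != 0, f \isn't a GRing.unit &
      forall g h : {poly int}, f = g * h ->
        (g \is a GRing.unit) \/ (h \is a GRing.unit)].

Definition is_splitting_field (K : splittingFieldType rat) (f : {poly int}) :
  Prop := splittingFieldFor 1 (map_poly intr f) {:K}.

Section Existence.
Variable R : realType.
Notation toC := (@ratr R[i]).
Notation pC := (map_poly toC).

Let PET (s : seq R[i]) : (forall x, x \in s -> algebraicOver toC x) ->
  exists z : R[i], [/\ algebraicOver toC z,
    exists a : nat -> nat, z = \sum_(i < size s) s`_i *+ a i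
  & exists ps : seq {poly rat}, s = [seq (pC p).[z] | p <- ps]].
Proof.
elim: s => [|x s IHs] algs.
  exists 0; split; first exact: algebraic0.
  - by exists (fun=> 0%N); rewrite big_ord0.
  - by exists nil.
have [y sy|z [algz [a Dz] [ps Ds]]] := IHs.
  by apply: algs; rewrite inE sy orbT.
have algx := algs x (mem_head _ _).
have [p nz_p px0] := algx.
have [q nz_q qz0] := algebraic_opp algz.
have [n [[pz Dpz] [px Dpx]]] := pchar0_PET nz_q qz0 nz_p px0 (@pchar_num rat).
rewrite opprK in Dpx Dpz; set w := x *+ n + z in Dpx Dpz.
have Dpz' : (pC (- pz)).[w] = z by rewrite rmorphN hornerN Dpz opprK.
exists w; split.
- apply: algebraic_add => //; rewrite -mulr_natr; apply: algebraic_mul => //.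
  by rewrite -[n%:R](rmorph_nat toC); apply: algebraic_id.
- exists (fun i => if i is j.+1 then a j else n).
  by rewrite big_ord_recl /= /w Dz.
- exists (px :: [seq p \Po (- pz) | p <- ps]) => /=; rewrite Dpx; congr (_ :: _).
  rewrite -map_comp Ds; apply: eq_map => r /=.
  by rewrite map_comp_poly horner_comp Dpz'.
Qed.

Let min_poly_exists (z : R[i]) : algebraicOver toC z ->
  exists r : {poly rat}, [/\ r != 0, root (pC r) z & irreducible_poly r].
Proof.
case=> p nz_p pz0.
pose P k := `[< exists r : {poly rat}, [/\ r != 0, root (pC r) z & size r = k] >].
have exP : exists k, P k by exists (size p); apply/asboolP; exists p.
case: (ex_minnP exP) => m /asboolP[r [nz_r rz0 sz_r]] min_m.
exists r; split=> //; apply/(subfx_irreducibleP rz0 nz_r) => q qz0 nz_q.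
by rewrite sz_r; apply: min_m; apply/asboolP; exists q.
Qed.

Lemma splitting_field_exists (f : {poly int}) : f != 0 ->
  exists (K : splittingFieldType rat) (iota : {rmorphism K -> R[i]}),
    is_splitting_field K f.
Proof.
move=> nz_f; pose g : {poly rat} := map_poly intr f.
have nz_g : g != 0 by rewrite map_poly_eq0_id0 // intr_eq0 lead_coef_eq0.
have [s Ds] := closed_field_poly_normal (pC g).
have nz_lc : lead_coef (pC g) != 0 by rewrite lead_coef_eq0 map_poly_eq0.
have algs x : x \in s -> algebraicOver toC x.
  by move=> sx; exists g => //; rewrite Ds rootZ // root_prod_XsubC.
have [z [algz [a Dz] [ps Dps]]] := PET algs.
have [r [nz_r rz0 irr_r]] := min_poly_exists algz.
suffices [Qs [QsC [z1 z1C z1gen]]] : exists (Qs : fieldExtType rat)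
    (QsC : {rmorphism Qs -> R[i]}),
    exists2 z1 : Qs, QsC z1 = z & forall x, exists p, fieldExt_horner z1 p = x.
  pose inQs := fieldExt_horner z1; pose s1 := map inQs ps.
  have inQsK p : QsC (inQs p) = (pC p).[z].
    rewrite /= -horner_map z1C -map_poly_comp; congr _.[z].
    by apply: eq_map_poly => b /=; rewrite alg_num_field fmorph_rat.
  have Ds1 : map QsC s1 = s by rewrite -map_comp Dps (eq_map inQsK).
  have sz_ps : size ps = size s by rewrite Dps size_map.
  have gen_s1 : <<1 & s1>>%VS = fullv.
    apply/vspaceP=> x; rewrite memvf; have [p <-] := z1gen x.
    rewrite -/inQs; elim/poly_ind: p => [|p b ApQs].
      by rewrite /inQs rmorph0 mem0v.
    rewrite /inQs rmorphD rmorphM /= fieldExt_hornerX fieldExt_hornerC -/inQs /=.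
    suffices ->: z1 = \sum_(i < size s) s1`_i *+ a i.
      rewrite memvD ?memvZ ?mem1v ?memvM ?memv_suml // => i _.
      by rewrite rpredMn ?seqv_sub_adjoin ?mem_nth // size_map sz_ps.
    apply: (fmorph_inj QsC); rewrite z1C Dz rmorph_sum; apply: eq_bigr => i _.
    by rewrite rmorphMn -(nth_map 0 0 QsC) ?Ds1 // size_map sz_ps.
  have splitf : splittingFieldFor 1 (map_poly intr f : {poly Qs}) {:Qs}.
    exists s1 => //; rewrite -(eqp_map QsC) rmorph_prod /=.
    have -> : map_poly QsC (map_poly intr f) = pC g.
      rewrite -!map_poly_comp; apply: eq_map_poly => b /=.
      by rewrite !rmorph_int.
    rewrite Ds (eqp_ltrans (eqp_scale _ nz_lc)) -Ds1 big_map.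
    under [X in _ %= X]eq_bigr do rewrite map_polyXsubC.
    exact: eqpxx.
  have Qs_ax : FieldExt_isSplittingField _ Qs.
    constructor; exists (map_poly intr f) => //.
    by apply/polyOverP => i; rewrite coef_map rpred_int.
  by exists (HB.pack_for (splittingFieldType rat) Qs Qs_ax), QsC.
exists (SubFieldExtType rz0 irr_r), (@subfx_inj _ _ toC z r).
exists (subfx_root _ z r) => [|x]; first exact: subfx_inj_root.
by have [p ->] := subfxEroot rz0 nz_r x; exists p.
Qed.

End Existence.

Section ConjugateLattice.
Variable R : realType.

Section Embeddings.
(* K is a splitting field over Q, viewed as a subfield of C through iota; its
   embeddings into C are then the [iota \o sigma] for sigma in Gal(K/Q). *)
Variables (K : splittingFieldType rat) (iota : {rmorphism K -> R[i]}).
Notation G := ('Gal({:K} / 1))%g.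

Definition Sigma (x : K) : 'rV[R[i]]_#|G| :=
  \row_(k < #|G|) iota ((enum_val k : gal_of {:K}) x).

Definition K_R : set 'rV[R[i]]_#|G| := real_span (range Sigma).

Definition conj_lattice (f : {poly int}) : set 'rV[R[i]]_#|G| :=
  int_span [set Sigma a | a in [set a : K | root (map_poly intr f) a]].

End Embeddings.

(* K ranges over all splitting fields of f with an embedding into C; at least
   one exists by [splitting_field_exists]. *)
Definition GWR_nearly_orthogonal_poly (n : nat) (f : {poly int}) : Prop :=
  [/\ size f = n.+1, Zpoly_irreducible f &
      forall (K : splittingFieldType rat) (iota : {rmorphism K -> R[i]}),
        is_splitting_field K f ->
        let L := conj_lattice iota f in
        [/\ lattice_of_rank (K_R iota) n L,
            generic_well_rounded n L,
            nearly_orthogonal n L &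
            exists b : 'I_n -> 'rV[R[i]]_#|('Gal({:K} / 1))%g|,
              lattice_basis L b /\ (forall i, min_vectors L (b i))]].

End ConjugateLattice.

(* Main.v *)
Require Import Defs.
From mathcomp Require Import all_boot all_order all_algebra all_fingroup all_field.
From mathcomp Require Import all_classical all_reals all_analysis.
From mathcomp Require Import complex polyorder zify ring lra.
Import Order.TTheory GRing.Theory Num.Theory.
Local Open Scope classical_set_scope.
Local Open Scope ring_scope.

(** By Perron's argument [x^n + a x^(n-1) + b] is irreducible and has a single
    root [theta] outside the open unit disc; it satisfies [|theta| >= 6 (n-1)].
    The Galois group permutes the roots transitively, so every root is sent to
    [theta] by the same number [S = d/n] of automorphisms.  The conjugate vectors
    of the roots thus have a common squared norm [M >= S |theta|^2], whereas two
    of them have inner product at most [S (n - 2 + 2 |theta|)], since [theta]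
    occurs in at most one factor of each term.  Hence the Gram matrix is
    [M (1 + E)] with the entries of [E] zero on the diagonal and bounded by some
    [eps] with [(n-1) eps <= 3/8] off it.  Diagonal dominance then gives linear
    independence, the minimal vectors (an integer vector other than 0 and the
    signed unit vectors has squared length at least 2) and the angles. *)

(** * Almost orthogonal families *)

Section AlmostOrthogonal.
Variables (R : realType) (d : nat).
Notation V := 'rV[R[i]]_d.
Notation toC := (real_complex R).
Implicit Types (x y : V).

Lemma ReD (u v : R[i]) : complex.Re (u + v) = complex.Re u + complex.Re v.
Proof. by case: u; case: v. Qed.

Lemma Re_sum (I : Type) (s : seq I) (F : I -> R[i]) :
  complex.Re (\sum_(i <- s) F i) = \sum_(i <- s) complex.Re (F i).
Proof. exact: (big_morph _ ReD). Qed.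

Lemma Re_realM (a : R) (u : R[i]) : complex.Re (toC a * u) = a * complex.Re u.
Proof. by case: u => u v /=; rewrite mul0r subr0. Qed.

Lemma conj_real (a : R) : (toC a)^* = toC a.
Proof. by apply/CrealP; rewrite complex_real. Qed.

Lemma herm_sumZ (m n : nat) (a : 'I_m -> R) (c : 'I_n -> R)
    (u : 'I_m -> V) (v : 'I_n -> V) :
  complex.Re (herm (\sum_i toC (a i) *: u i) (\sum_j toC (c j) *: v j)) =
  \sum_i \sum_j a i * c j * complex.Re (herm (u i) (v j)).
Proof.
rewrite /herm.
under eq_bigr => k _.
  rewrite !summxE rmorph_sum mulr_suml.
  under eq_bigr => i _.
    rewrite mulr_sumr.
    under eq_bigr => j _.
      rewrite !mxE rmorphM /= conj_real.
      rewrite (_ : _ * _ = toC (a i) * (toC (c j) * (u i 0 k * (v j 0 k)^*)));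
        last by ring.
      over.
    over.
  over.
rewrite exchange_big /= Re_sum; apply: eq_bigr => i _.
rewrite exchange_big /= Re_sum; apply: eq_bigr => j _.
by rewrite -!mulr_sumr !Re_realM mulrA.
Qed.

Lemma hermN x : herm (- x) (- x) = herm x x.
Proof.
by apply: eq_bigr => k _; rewrite !mxE rmorphN mulrNN.
Qed.

Lemma herm_ge0 x : 0 <= complex.Re (herm x x).
Proof.
rewrite /herm Re_sum; apply: sumr_ge0 => k _.
by case: (x 0 k) => a b /=; rewrite mulrN opprK -!expr2 addr_ge0 ?sqr_ge0.
Qed.

Lemma norm2_le x y :
  (norm2 x <= norm2 y) = (complex.Re (herm x x) <= complex.Re (herm y y)).
Proof. by rewrite /norm2 ler_psqrt ?nnegrE ?herm_ge0. Qed.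

(** With [c = cos (pi / 3)], expanding [cos pi] as a triple angle gives [4 c^3 - 3 c + 1 = (c + 1)
    (2 c - 1)^2 = 0], and [c > 0]. *)
Lemma cos_pi3 : cos (pi / 3) = 1 / 2 :> R.
Proof.
have pi0 := pi_gt0 R.
have c0 : 0 < cos (pi / 3) :> R by apply: cos_gt0_pihalf; lra.
have : cos (pi / 3 + (pi / 3) *+ 2) = -1 :> R.
  by rewrite -cospi; congr cos; rewrite mulr2n; lra.
rewrite cosD cos_mulr2n sin_mulr2n.
have -> : sin (pi / 3) * ((cos (pi / 3) * sin (pi / 3)) *+ 2) =
  cos (pi / 3) * (sin (pi / 3) ^+ 2) *+ 2 :> R by rewrite !mulr2n; ring.
rewrite sin2cos2; set c := cos _ in c0 *; move=> H.
have : (c + 1) * (2 * c - 1) ^+ 2 = 0.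
  by move: H; rewrite !mulr2n; lra.
move/eqP; rewrite mulf_eq0 sqrf_eq0 => /orP[/eqP|/eqP]; lra.
Qed.

Lemma acos_ge_pi3 (t : R) : `|t| <= 1 / 2 -> pi / 3 <= acos t.
Proof.
rewrite ler_norml => /andP[t1 t2]; have pi0 := pi_gt0 R.
have t11 : -1 <= t <= 1 by apply/andP; split; lra.
rewrite leNgt; apply/negP => lt.
have : cos (pi / 3) < cos (acos t).
  by rewrite ltr_cos // in_itv /= ?acos_ge0 ?acos_lepi //; apply/andP; split; lra.
rewrite cos_pi3 acosK ?in_itv //=; lra.
Qed.

Variables (n : nat) (b : 'I_n -> V) (M eps : R).

Definition comb (c : 'I_n -> R) : V := \sum_i toC (c i) *: b i.

Lemma comb_delta i : comb (fun j => (j == i)%:R) = b i.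
Proof.
rewrite /comb (bigD1 i) //= eqxx scale1r big1 ?addr0 // => j /negPf ->.
by rewrite scale0r.
Qed.

Lemma herm_comb c e : complex.Re (herm (comb c) (comb e)) =
  \sum_i \sum_j c i * e j * complex.Re (herm (b i) (b j)).
Proof. exact: herm_sumZ. Qed.

Lemma combD c e : comb (fun i => c i + e i) = comb c + comb e.
Proof.
rewrite /comb -big_split; apply: eq_bigr => i _.
by rewrite rmorphD scalerDl.
Qed.

Lemma combZ a c : comb (fun i => a * c i) = toC a *: comb c.
Proof.
by rewrite /comb scaler_sumr; apply: eq_bigr => i _; rewrite rmorphM scalerA.
Qed.

Lemma comb0 : comb (fun=> 0) = 0.
Proof. by rewrite /comb big1 // => i _; rewrite scale0r. Qed.

(** Coefficients supported on [J] let one Gram matrix, indexed by all of ['I_n], serve the span of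
    every subfamily. *)
Lemma real_span_comb (J : set 'I_n) v : real_span (b @` J) v ->
  exists2 c, v = comb c & forall i, ~ J i -> c i = 0.
Proof.
case=> m [a [w [Jw ->]]].
apply: (big_ind (fun v => exists2 c, v = comb c & forall i, ~ J i -> c i = 0)).
- by exists (fun=> 0); rewrite ?comb0.
- move=> _ _ [c -> Hc] [e -> He]; exists (fun i => c i + e i).
    by rewrite combD.
  by move=> i Ji; rewrite Hc // He // addr0.
- move=> k _; have [j Jj <-] := Jw k.
  exists (fun i => a k * (i == j)%:R); first by rewrite combZ comb_delta.
  by move=> i nJi; case: eqP => [ij|_]; [case: nJi; rewrite ij|rewrite mulr0].
Qed.

Lemma toCint (k : int) (v : V) : toC k%:~R *: v = v *~ k.
Proof. by rewrite rmorph_int scaler_int. Qed.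

Lemma int_span_comb v : int_span (range b) v ->
  exists k : 'I_n -> int, v = comb (fun i => (k i)%:~R).
Proof.
case=> m [a [w [Jw ->]]].
apply: (big_ind (fun v => exists k : 'I_n -> int, v = comb (fun i => (k i)%:~R))).
- by exists (fun=> 0); rewrite -[LHS]comb0.
- move=> _ _ [c ->] [e ->]; exists (fun i => c i + e i).
  by rewrite -combD; congr comb; apply/funext => i; rewrite intrD.
- move=> k _; have [j _ <-] := Jw k.
  exists (fun i => a k * (i == j)%:Z).
  rewrite -toCint -[in LHS]comb_delta -combZ; congr comb; apply/funext => i.
  by rewrite intrM; case: eqP.
Qed.

(** * Diagonally dominant Gram matrices *)

Hypotheses (n_ge3 : (3 <= n)%N) (M_gt0 : 0 < M) (eps_ge0 : 0 <= eps).
Hypothesis eps_small : (n%:R - 1) * eps <= 3 / 8.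
Hypothesis diagM : forall i, complex.Re (herm (b i) (b i)) = M.
Hypothesis offdiag : forall i j, i != j ->
  `|complex.Re (herm (b i) (b j))| <= eps * M.

Let nR : 3 <= n%:R :> R.
Proof. by rewrite ler_nat. Qed.

(** Off the diagonal this is [2 |u v| <= u^2 + v^2]. The indicator term restores the diagonal entry
    [M c_i^2], so that the bound sums uniformly over all pairs. *)
Lemma gram_entry_ge (c : 'I_n -> R) i j :
  - (eps * M * ((c i ^+ 2 + c j ^+ 2) / 2))
    + (j == i)%:R * ((1 + eps) * M * c i ^+ 2)
    <= c i * c j * complex.Re (herm (b i) (b j)).
Proof.
have [->|ji] := eqVneq j i; first by rewrite diagM mul1r; lra.
rewrite mul0r addr0; set u := c i; set v := c j.
have H : `|u * v| <= (u ^+ 2 + v ^+ 2) / 2.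
  by rewrite ler_norml; have := sqr_ge0 (u - v); have := sqr_ge0 (u + v); nra.
have : `|u * v * complex.Re (herm (b i) (b j))|
    <= eps * M * ((u ^+ 2 + v ^+ 2) / 2).
  by rewrite normrM mulrC ler_pM // offdiag // eq_sym.
by rewrite ler_norml => /andP[].
Qed.

(** A Gershgorin bound on the least eigenvalue: the entrywise estimates add up to the factor
    [1 + eps - n eps]. *)
Lemma gram_lower (c : 'I_n -> R) :
  M * (1 - (n%:R - 1) * eps) * \sum_i c i ^+ 2
    <= complex.Re (herm (comb c) (comb c)).
Proof.
rewrite herm_comb.
apply: le_trans (ler_sum _ (fun i _ => ler_sum _ (fun j _ => gram_entry_ge c i j))).
set S := \sum_i c i ^+ 2.
rewrite (eq_bigr (fun i => - (eps * M * ((c i ^+ 2 *+ n + S) / 2)) +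
    (1 + eps) * M * c i ^+ 2)); last first.
  move=> i _; rewrite big_split /=; congr (_ + _).
    by rewrite sumrN -mulr_sumr -mulr_suml big_split /= sumr_const card_ord.
  rewrite (bigD1 i) //= eqxx mul1r big1 ?addr0 // => j /negPf ->.
  by rewrite mul0r.
rewrite big_split /= -mulr_sumr sumrN -mulr_sumr -mulr_suml big_split /=.
rewrite -/S sumrMnl sumr_const card_ord -(mulr_natr S n).
by rewrite le_eqVlt; apply/orP; left; apply/eqP; field.
Qed.

Lemma real_free_b : real_free b.
Proof.
move=> c; rewrite -/(comb c) => c0; have := gram_lower c.
have -> : complex.Re (herm (comb c) (comb c)) = 0.
  by rewrite c0 /herm big1 // => k _; rewrite mxE mul0r.
move=> H.
have H2 : \sum_i c i ^+ 2 <= 0.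
  have p : 0 < M * (1 - (n%:R - 1) * eps) by rewrite mulr_gt0 //; move: eps_small; lra.
  by rewrite -(pmulr_rle0 _ p).
have : \sum_i c i ^+ 2 == 0.
  by rewrite eq_le H2 sumr_ge0 // => i _; apply: sqr_ge0.
rewrite psumr_eq0 => [/allP H3 i|i _]; last exact: sqr_ge0.
by apply/eqP; rewrite -sqrf_eq0; apply: H3; rewrite mem_index_enum.
Qed.

Lemma comb_inj c e : comb c = comb e -> c = e.
Proof.
move=> ce.
have ce0 : comb (fun i => c i + (-1) * e i) = 0.
  by rewrite combD combZ rmorphN1 scaleN1r ce subrr.
apply/funext => i; have := real_free_b _ ce0 i.
by rewrite mulN1r => /subr0_eq.
Qed.

(* Doubling the [k]-th row and column of the Gram matrix off the diagonal keeps
   it positive semidefinite: this is the discriminant form of the statement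
   that the angle at [b k] is at least pi/3. *)
Lemma gram_half k c : c k = 0 ->
  4 * complex.Re (herm (b k) (comb c)) ^+ 2
    <= M * complex.Re (herm (comb c) (comb c)).
Proof.
move=> ck; set B := complex.Re (herm (b k) _); set N := complex.Re _.
(* The cross term is twice that of the squared length of [x b_k + comb c]; this doubling produces
   the constant 4 in the discriminant. *)
have main (x : R) : 0 <= M * x ^+ 2 + 4 * x * B + N.
  have HB : B = \sum_j c j * complex.Re (herm (b k) (b j)).
    rewrite /B -[in LHS](comb_delta k) herm_comb (bigD1 k) //= [X in _ + X]big1 ?addr0.
      by apply: eq_bigr => j _; rewrite eqxx mul1r.
    by move=> i /negPf ->; rewrite big1 // => j _; rewrite !mul0r.
  have entry j : - (2 * eps * M * ((j != k)%:R * x ^+ 2 + c j ^+ 2)) <=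
      4 * x * (c j * complex.Re (herm (b k) (b j))).
    have [->|jk] := eqVneq j k; first by rewrite ck /=; lra.
    rewrite /= mul1r.
    have H : `|x * c j| <= (x ^+ 2 + c j ^+ 2) / 2.
      by rewrite ler_norml; have := sqr_ge0 (x - c j); have := sqr_ge0 (x + c j); nra.
    have : `|x * c j * complex.Re (herm (b k) (b j))| <=
        eps * M * ((x ^+ 2 + c j ^+ 2) / 2).
      by rewrite normrM mulrC ler_pM // offdiag // eq_sym.
    by rewrite ler_norml => /andP[]; lra.
  have := ler_sum (index_enum 'I_n) (P := xpredT) (fun j _ => entry j).
  rewrite -mulr_sumr -HB sumrN -mulr_sumr big_split /= -mulr_suml.
  have -> : \sum_(j < n) (j != k)%:R = n%:R - 1 :> R.
    rewrite (bigD1 k) //= eqxx add0r (eq_bigr (fun=> 1)); last by move=> i ->.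
    by rewrite sumr_const cardC1 card_ord -subn1 natrB // (leq_trans _ n_ge3).
  have := gram_lower c; rewrite -/N.
  set S := \sum_i _ => H1 H2.
  have S0 : 0 <= S by apply: sumr_ge0 => i _; apply: sqr_ge0.
  have x0 := sqr_ge0 x.
  (* The estimates leave [M x^2 (1 - 2 (n - 1) eps) + M S (1 - (n + 1) eps)]. Both factors are at
     least [1/4], since [n + 1 <= 2 (n - 1)] for [n >= 3]. *)
  have E1 : 0 <= M * x ^+ 2 * (1 - 2 * ((n%:R - 1) * eps)).
    by apply: mulr_ge0; [apply: mulr_ge0 => //; apply: ltW|move: eps_small; lra].
  have E2 : 0 <= M * S * (1 - (n%:R + 1) * eps).
    apply: mulr_ge0; first by apply: mulr_ge0 => //; apply: ltW.
    have : (n%:R + 1) * eps <= 2 * (n%:R - 1) * eps.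
      by apply: ler_wpM2r => //; move: nR; lra.
    move: eps_small; lra.
  nra.
(* The minimum of the quadratic. *)
have := main (- (2 * B / M)).
have -> : M * (- (2 * B / M)) ^+ 2 + 4 * - (2 * B / M) * B + N = (M * N - 4 * B ^+ 2) / M.
  by field; rewrite gt_eqF.
by rewrite pmulr_lge0 ?invr_gt0 // subr_ge0.
Qed.

(** By [gram_half] the cosine has absolute value at most [1/2]. *)
Lemma angle_ge k c : c k = 0 -> pi / 3 <= angle (b k) (comb c).
Proof.
move=> ck; apply: acos_ge_pi3.
have := gram_half k c ck; set B := complex.Re (herm (b k) _); set N := complex.Re _.
move=> H; rewrite /norm2 diagM -/N -sqrtrM ?(ltW M_gt0) // normrM normfV.
rewrite [`|Num.sqrt _|]ger0_norm ?sqrtr_ge0 //.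
have N0 : 0 <= N by apply: herm_ge0.
have H2 : `|2 * B| <= Num.sqrt (M * N).
  rewrite -sqrtr_sqr ler_psqrt ?nnegrE ?sqr_ge0 ?mulr_ge0 ?(ltW M_gt0) //.
  by move: H; rewrite exprMn; lra.
(* If [comb c] vanishes, division by zero makes the quotient 0, which still satisfies the bound. *)
have [E|nz] := eqVneq (Num.sqrt (M * N)) 0; first by rewrite E invr0 mulr0; lra.
rewrite ler_pdivrMr ?lt_neqAle 1?eq_sym ?nz ?sqrtr_ge0 //.
by move: H2; rewrite normrM ger0_norm //; lra.
Qed.

Lemma nearly_orthogonal_b : nearly_orthogonal_basis b.
Proof.
move=> s k k0; rewrite /angle_subspace.
(* The vectors preceding position [k] in the order [s], as a subfamily of [b]. It omits the index
   [s k], so [angle_ge] will apply. *)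
have img : (fun i => b (s i)) @` [set j : 'I_n | (j < k)%N] =
    b @` [set i | ((s^-1)%g i < k)%N].
  apply/seteqP; split => _ [j /= jk <-].
    by exists (s j) => //=; rewrite permK.
  by exists ((s^-1)%g j) => //=; rewrite permKV.
rewrite img; apply: lb_le_inf.
  have n0 : (0 < n)%N by apply: leq_trans n_ge3.
  (* The infimum runs over a nonempty set: as [0 < k], the first vector in the order [s] is a
     nonzero element of the span. *)
  exists (angle (b (s k)) (b (s (Ordinal n0)))), (b (s (Ordinal n0))) => //; split.
    exists 1%N, (fun=> 1), (fun=> b (s (Ordinal n0))); split.
      by move=> _; exists (s (Ordinal n0)) => //=; rewrite permK.
    by rewrite big_ord1 scale1r.
  move=> /= b0; have := diagM (s (Ordinal n0)); rewrite b0 /herm big1.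
    by move/eqP; rewrite eq_sym gt_eqF.
  by move=> i _; rewrite mxE mul0r.
move=> _ [w [/real_span_comb[c -> cJ] _] <-]; apply: angle_ge.
by apply: cJ => /=; rewrite permK ltnn.
Qed.

(** * Minimal vectors *)

Let L := int_span (range b).

Lemma L_b i : L (b i).
Proof.
by exists 1%N, (fun=> 1), (fun=> b i); split => [_|]; [exists i|rewrite big_ord1].
Qed.

Lemma b_neq0 i : b i != 0.
Proof.
apply/eqP => b0; have := diagM i; rewrite b0 /herm big1.
  by move/eqP; rewrite eq_sym gt_eqF.
by move=> j _; rewrite mxE mul0r.
Qed.

(** A boolean sign indexes these vectors by a finite type with [2 n] elements. *)
Definition signed_unit (s : bool) (i : 'I_n) : 'I_n -> int :=
  fun j => if j == i then (-1) ^+ s else 0.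

Lemma comb_signed_unit s i :
  comb (fun j => (signed_unit s i j)%:~R) = (-1) ^+ s *: b i.
Proof.
have -> : (-1) ^+ s *: b i = toC ((-1) ^+ s) *: comb (fun j => (j == i)%:R).
  by rewrite comb_delta rmorphXn rmorphN1.
rewrite -combZ; congr comb; apply/funext => j; rewrite /signed_unit.
by case: eqP => _; rewrite ?mulr0 // mulr1 rmorphXn rmorphN1.
Qed.

(** Two nonzero entries contribute at least 1 each; a single entry of absolute value at least 2
    contributes at least 4. *)
Lemma int_sqr_sum_small (k : 'I_n -> int) :
  (exists (s : bool) i, k = signed_unit s i) \/ (forall i, k i = 0) \/
  2 <= \sum_i (k i)%:~R ^+ 2 :> R.
Proof.
have sqr_ge1 (z : int) : z != 0 -> 1 <= z%:~R ^+ 2 :> R.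
  move=> z0; rewrite -rmorphXn /= ler1z; have := sqrf_eq0 z.
  by rewrite (negPf z0); have := sqr_ge0 z; case: (z ^+ 2) => [[|m]|m].
have sge0 (P : pred 'I_n) : 0 <= \sum_(i | P i) (k i)%:~R ^+ 2 :> R.
  by apply: sumr_ge0 => i _; apply: sqr_ge0.
have [/existsP[i ki]|] := boolP [exists i, k i != 0]; last first.
  rewrite negb_exists => /forallP H; right; left => i.
  by apply/eqP; rewrite -[_ == _]negbK.
have [/existsP[j /andP[ji kj]]|] := boolP [exists j, (j != i) && (k j != 0)].
  right; right; rewrite (bigD1 i) // (bigD1 j) //=.
  have := sqr_ge1 _ ki; have := sqr_ge1 _ kj.
  by have := sge0 (fun l => (l != i) && (l != j)); lra.
rewrite negb_exists => /forallP H.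
have H0 j : j != i -> k j = 0.
  by move=> ji; have := H j; rewrite ji negbK => /eqP.
case: (boolP (`|k i| <= 1)) => k1; last first.
  right; right; rewrite (bigD1 i) //=; have := sge0 (fun l => l != i).
  suff : 2 <= (k i)%:~R ^+ 2 :> R by lra.
  have : 2 <= `|(k i)%:~R| :> R.
    by rewrite -intr_norm (ler_int _ 2); move: k1; rewrite -ltNge.
  by rewrite -[(k i)%:~R ^+ 2]real_normK ?num_real //; nra.
left; exists (k i < 0), i; apply/funext => j; rewrite /signed_unit.
case: eqP => [->|/eqP /H0 //].
by move: ki k1; case: (k i) => [[|[|m]]|[|m]].
Qed.

(** By [gram_lower], a square sum of at least 2 forces squared length at least
    [2 (1 - 3/8) M = 5/4 M], which exceeds [M]. *)
Lemma min_vectorsE :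
  min_vectors L = [set v | exists (s : bool) i, v = (-1) ^+ s *: b i].
Proof.
have normb (s : bool) i : complex.Re (herm ((-1) ^+ s *: b i) ((-1) ^+ s *: b i)) = M.
  by case: s; rewrite ?expr0 ?expr1 ?scale1r ?scaleN1r ?hermN diagM.
have lowL y : L y -> y != 0 -> (exists (s : bool) i, y = (-1) ^+ s *: b i) \/
    M < complex.Re (herm y y).
  move=> /int_span_comb[k ->] nz.
  have [[s [i ->]]|[k0|k2]] := int_sqr_sum_small k.
  - by left; exists s, i; rewrite comb_signed_unit.
  - case/eqP: nz; rewrite -[RHS]comb0; congr comb; apply/funext => i.
    by rewrite k0.
  - right; apply: lt_le_trans (gram_lower _).
    set S := \sum_i _ in k2 *.
    have : M * (1 - (n%:R - 1) * eps) * 2 <= M * (1 - (n%:R - 1) * eps) * S.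
      apply: ler_wpM2l => //; apply: mulr_ge0; first exact: ltW.
      by move: eps_small; lra.
    apply: lt_le_trans.
    have : M * ((n%:R - 1) * eps) <= M * (3 / 8) by apply: ler_wpM2l => //; exact: ltW.
    by move: M_gt0; lra.
apply/seteqP; split => v /=.
  case=> Lv v0 vmin; have [//|] := lowL v Lv v0.
  have i : 'I_n by apply: Ordinal (leq_trans (isT : (0 < 3)%N) n_ge3).
  by have := vmin (b i) (L_b i) (b_neq0 i); rewrite norm2_le diagM leNgt => /negPf ->.
move=> [s [i ->]]; split.
- case: s; rewrite ?expr0 ?expr1 ?scale1r ?scaleN1r; last exact: L_b.
  exists 1%N, (fun=> -1), (fun=> b i); split => [_|]; first by exists i.
  by rewrite big_ord1.
- by rewrite scaler_eq0 signr_eq0 (negPf (b_neq0 i)).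
- move=> y Ly y0; rewrite norm2_le normb.
  by have [[t [j ->]]|/ltW //] := lowL y Ly y0; rewrite normb.
Qed.

Lemma min_b i : min_vectors L (b i).
Proof. by rewrite min_vectorsE; exists false, i; rewrite scale1r. Qed.

Lemma card_min_vectors : (min_vectors L #= `I_(2 * n))%card.
Proof.
pose g (p : bool * 'I_n) : V := (-1) ^+ p.1 *: b p.2.
have g_inj : injective g.
  move=> [s i] [t j]; rewrite /g /= -!comb_signed_unit => /comb_inj E.
  have {}E l : signed_unit s i l = signed_unit t j l.
    by apply: (@intr_inj R); have /= := congr1 (@^~ l) E.
  have := E i; rewrite /signed_unit eqxx.
  by case: eqP => [->|_]; case: s {E}; case: t.
have -> : min_vectors L = g @` [set: bool * 'I_n].
  rewrite min_vectorsE; apply/seteqP; split => v /=.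
    by move=> [s [i ->]]; exists (s, i).
  by move=> [[s i] _ <-]; exists s, i.
have -> : `I_(2 * n) = (fun p => enum_rank p : nat) @` [set: bool * 'I_n].
  have cardE : #|{: bool * 'I_n}| = (2 * n)%N.
    by rewrite card_prod card_bool card_ord.
  rewrite -cardE; apply/seteqP; split => [m /= lt_m|_ [p _ <-] /=].
    by exists (enum_val (Ordinal lt_m)); rewrite ?enum_valK.
  exact: ltn_ord.
apply: card_eq_trans (inj_card_eq (in2W g_inj)) _.
rewrite card_eq_sym; apply: inj_card_eq => p q _ _ /ord_inj.
exact: enum_rank_inj.
Qed.

Lemma generic_well_rounded_b : generic_well_rounded n L.
Proof.
split; last exact: card_min_vectors.
by exists b; split; [exact: min_b | exact: real_free_b].
Qed.

Lemma lattice_basis_b : lattice_basis L b.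
Proof. by split => //; exact: real_free_b. Qed.

End AlmostOrthogonal.

(** * Perron's criterion for trinomials *)

Section Perron.
Variable R : realType.
Notation abs := (@Normc.normc R).
Implicit Types (x y : R[i]).

Lemma abs_ge0 x : 0 <= abs x.
Proof. by case: x => u v; rewrite sqrtr_ge0. Qed.

Lemma absX x n : abs (x ^+ n) = abs x ^+ n.
Proof.
by elim: n => [|n IH]; rewrite ?expr0 ?Normc.normc1 // !exprS Normc.normcM IH.
Qed.

Lemma abs_int (z : int) : abs z%:~R = `|z|%:~R.
Proof.
rewrite -(rmorph_int (real_complex R)) /= expr0n addr0 sqrtr_sqr.
by rewrite intr_norm.
Qed.

Lemma abs_sum (I : Type) (s : seq I) (F : I -> R[i]) :
  abs (\sum_(i <- s) F i) <= \sum_(i <- s) abs (F i).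
Proof.
elim/big_ind2: _ => [|x r y t xr yt|//]; first by rewrite Normc.normc0.
exact: le_trans (le_normcD _ _) (lerD xr yt).
Qed.

(** By Vieta, the constant term is up to sign the leading coefficient times the product of the
    roots. The contrapositive produces roots outside the open unit disc. *)
Lemma abs_horner0_lt (p : {poly R[i]}) : (1 < size p)%N ->
  (forall x, root p x -> abs x < 1) -> abs p.[0] < abs (lead_coef p).
Proof.
have [s Ds] := closed_field_poly_normal p => sz_p small.
have lc0 : lead_coef p != 0 by rewrite lead_coef_eq0 -size_poly_gt0 ltnW.
have {}small x : x \in s -> abs x < 1.
  by move=> xs; apply: small; rewrite Ds rootZ // root_prod_XsubC.
have : s != [::].
  by apply: contraTneq sz_p => s0; rewrite Ds s0 big_nil alg_polyC size_polyC lc0.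
have lcp : 0 < abs (lead_coef p).
  rewrite lt_neqAle abs_ge0 andbT eq_sym; apply: contra lc0 => /eqP.
  by move/Normc.eq0_normc ->.
rewrite Ds hornerZ Normc.normcM -Ds => s0.
rewrite -[ltRHS]mulr1 ltr_pM2l //.
(* One root is split off to make the inequality strict; the others only give a product at most 1. *)
case: s {Ds} s0 small => // x s _ small.
rewrite big_cons hornerM hornerXsubC Normc.normcM sub0r normcN.
have : abs (\prod_(z <- s) ('X - z%:P)).[0] <= 1.
  have {}small z : z \in s -> abs z < 1 by move=> zs; apply: small; rewrite inE zs orbT.
  elim: s small => [|z s IH] small; first by rewrite big_nil hornerC Normc.normc1.
  rewrite big_cons hornerM hornerXsubC Normc.normcM sub0r normcN.
  rewrite mulr_ile1 ?abs_ge0 ?IH //; first by rewrite ltW // small ?mem_head.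
  by move=> w ws; apply: small; rewrite inE ws orbT.
have := small x (mem_head _ _); have := abs_ge0 x.
set u := abs x; set v := abs _ => *; have : 0 <= v by apply: abs_ge0.
nra.
Qed.

Variables (m : nat) (a b : int).
Definition trinomial : {poly int} := 'X^(m.+1) + a%:P * 'X^m + b%:P.
Local Notation f := trinomial.
Local Notation F := (map_poly intr f : {poly R[i]}).
Hypotheses (b_neq0 : b != 0) (ltab : `|b| + 1 < `|a|) (m_gt0 : (0 < m)%N).

(** The quotient of [F] by [X - th], written so as to isolate [a + th], whose modulus is
    [|b| / |th|^m]. *)
Definition cofactor (th : R[i]) : {poly R[i]} :=
  'X^m + (a%:~R + th)%:P * \sum_(i < m) 'X^(m.-1 - i) * th%:P ^+ i.

Let size_low : (size (a%:P * 'X^m + b%:P : {poly int})%R <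
  size ('X^(m.+1) : {poly int})%R)%N.
Proof.
rewrite size_polyXn ltnS; apply: leq_trans (size_polyD _ _) _; rewrite geq_max.
rewrite (leq_trans (size_polyC_leq1 _)) // andbT.
by rewrite mul_polyC (leq_trans (size_scale_leq _ _)) // size_polyXn.
Qed.

Lemma size_trinomial : size f = m.+2.
Proof. by rewrite /trinomial -addrA size_polyDl // size_polyXn. Qed.

Lemma trinomial_monic : f \is monic.
Proof.
by apply/monicP; rewrite /trinomial -addrA lead_coefDl // lead_coefXn.
Qed.

Lemma map_trinomial :
  F = 'X^(m.+1) + (a%:~R)%:P * 'X^m + (b%:~R)%:P.
Proof. by rewrite !rmorphD rmorphM /= !map_polyXn !map_polyC. Qed.

Lemma trinomial_root x : root F x = (x ^+ m * (x + a%:~R) == - b%:~R).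
Proof.
rewrite map_trinomial /root !(hornerD, hornerM, hornerXn, hornerC).
by rewrite -[RHS]subr_eq0 opprK; congr (_ == _); rewrite exprS; ring.
Qed.

Lemma trinomial_factor th : root F th -> F = ('X - th%:P) * cofactor th.
Proof.
rewrite trinomial_root map_trinomial /cofactor => /eqP E.
rewrite mulrDr mulrCA -subrXX -[b%:~R]opprK -E.
rewrite !rmorphN rmorphM rmorphXn !rmorphD /= exprS; ring.
Qed.

Let aR : `|b|%:~R + 1 < `|a|%:~R :> R.
Proof. by rewrite -(@intrD _ _ 1) ltr_int. Qed.

(** Put [c = th + a], so that [|c| |th|^m = |b|]. If [|y| >= 1], solving for [y^m] gives
    [1 <= |c| S] with [S] the sum of [|th|^i] for [i < m]. Multiplying by [|th| - 1] yields
    [|th| + |c| <= |b| + 1], contrary to [|a| <= |th| + |c|]. *)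
Lemma cofactor_root_lt1 th y : root F th -> 1 <= abs th ->
  root (cofactor th) y -> abs y < 1.
Proof.
rewrite trinomial_root => /eqP thE th_ge1 yroot.
rewrite ltNge; apply/negP => y_ge1.
set c := th + a%:~R in thE.
have A0 := abs_ge0 th; have C0 := abs_ge0 c; have Y0 := abs_ge0 y.
have cA : abs c * abs th ^+ m = `|b|%:~R.
  by rewrite -absX -Normc.normcM mulrC thE normcN abs_int.
have Yp : 0 < abs y ^+ m by rewrite exprn_gt0 // (lt_le_trans ltr01).
have yE : y ^+ m = - (c * \sum_(i < m) y ^+ (m.-1 - i) * th ^+ i).
  move/rootP: yroot; rewrite /cofactor hornerD hornerM hornerXn hornerC.
  rewrite horner_sum => /eqP; rewrite addr_eq0 => /eqP ->.
  rewrite [a%:~R + th]addrC; congr (- (_ * _)); apply: eq_bigr => i _.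
  by rewrite hornerM hornerXn -rmorphXn /= hornerC.
have cS : 1 <= abs c * \sum_(i < m) abs th ^+ i.
  rewrite -(ler_pM2l Yp) mulr1 -[leLHS]absX yE normcN Normc.normcM.
  rewrite mulrCA; apply: ler_wpM2l => //; apply: le_trans (abs_sum _ _ _) _.
  rewrite mulr_sumr; apply: ler_sum => i _.
  rewrite Normc.normcM !absX ler_wpM2r ?exprn_ge0 //.
  by apply: ler_weXn2l => //; rewrite (leq_trans (leq_subr _ _)) // leq_pred.
have aC : `|a|%:~R <= abs th + abs c.
  rewrite -abs_int (_ : a%:~R = - th + c); last by rewrite /c addKr.
  by rewrite -[abs th]normcN le_normcD.
have := subrX1 (abs th) m; set S := \sum_(i < m) _ in cS *.
set X := abs th ^+ m in cA *; move: aR; rewrite -cA.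
have : (abs th - 1) * 1 <= (abs th - 1) * (abs c * S).
  by apply: ler_wpM2l => //; rewrite subr_ge0.
move=> H1 H2 H3.
have H4 : abs c * X - abs c = (abs th - 1) * (abs c * S).
  by rewrite mulrCA -H3; ring.
lra.
Qed.

Let F_size : size F = m.+2.
Proof. by rewrite size_map_inj_poly ?size_trinomial //; exact: intr_inj. Qed.

Let F_lead : lead_coef F = 1.
Proof.
by rewrite lead_coef_map_inj ?(monicP trinomial_monic) //; exact: intr_inj.
Qed.

Lemma b_abs_ge1 : 1 <= `|b|%:~R :> R.
Proof. by rewrite ler1z -gtz0_ge1 normr_gt0. Qed.

Lemma large_root : exists2 th, root F th & 1 <= abs th.
Proof.
apply: contrapT => no_large.
have : abs F.[0] < abs (lead_coef F).
  apply: abs_horner0_lt => [|x Fx]; first by rewrite F_size.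
  by rewrite ltNge; apply/negP => x1; apply: no_large; exists x.
rewrite F_lead Normc.normc1 map_trinomial !(hornerD, hornerM, hornerXn, hornerC).
rewrite exprS mul0r expr0n eqn0Ngt m_gt0 /= mulr0 !add0r abs_int.
by have := b_abs_ge1; lra.
Qed.

(** The root lies at distance [|b| / |th|^m] from [-a], and integrality sharpens the hypothesis to
    [|a| >= |b| + 2]. *)
Lemma large_root_ge th : root F th -> 1 <= abs th ->
  `|b|%:~R + 2 - `|b|%:~R / abs th ^+ m <= abs th.
Proof.
rewrite trinomial_root => /eqP thE th_ge1.
set c := th + a%:~R in thE.
have Xp : 0 < abs th ^+ m by rewrite exprn_gt0 // (lt_le_trans ltr01).
have cA : abs c = `|b|%:~R / abs th ^+ m.
  apply/eqP; rewrite eq_sym -[_ == _](inj_eq (mulIf (lt0r_neq0 Xp))) divfK ?lt0r_neq0 //.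
  by rewrite -absX -Normc.normcM mulrC thE normcN abs_int.
have aC : `|a|%:~R <= abs th + abs c.
  rewrite -abs_int (_ : a%:~R = - th + c); last by rewrite /c addKr.
  by rewrite -[abs th]normcN le_normcD.
have : `|b|%:~R + 2 <= `|a|%:~R :> R.
  by rewrite -(@intrD _ _ 2) ler_int -[2]/(1 + 1) addrA lezD1.
by rewrite -cA; lra.
Qed.

(** A nonconstant factor has leading coefficient of absolute value 1 and a nonzero integer constant
    term, hence a root of modulus at least 1. Two such factors would share the only large root,
    making it a double root, but the cofactor has no large root. *)
Lemma trinomial_no_factor (g h : {poly int}) : f = g * h ->
  (size g == 1)%N || (size h == 1)%N.
Proof.
move=> fE; apply/norP => -[g1 h1].
have f_neq0 : f != 0 by rewrite -size_poly_gt0 size_trinomial.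
have /norP[g0 h0] : ~~ ((g == 0) || (h == 0)) by rewrite -mulf_eq0 -fE.
have f0 : f.[0] = b.
  rewrite /trinomial !(hornerD, hornerM, hornerXn, hornerC).
  by rewrite exprS mul0r expr0n eqn0Ngt m_gt0 /= mulr0 !add0r.
have large (p q : {poly int}) : f = p * q -> size p != 1%N -> p != 0 ->
    exists2 th, root (map_poly intr p : {poly R[i]}) th & 1 <= abs th.
  move=> pq p1 p0; apply: contrapT => no_large.
  have := abs_horner0_lt (map_poly intr p).
  rewrite size_map_inj_poly //; last exact: intr_inj.
  rewrite lead_coef_map_inj //; last exact: intr_inj.
  rewrite -(rmorph0 intr) horner_map !abs_int ltr_int => H.
  have {H} : `|p.[0]| < `|lead_coef p|.
    apply: H => [|x px].
      by rewrite ltn_neqAle eq_sym p1 size_poly_gt0.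
    by rewrite ltNge; apply/negP => x1; apply: no_large; exists x.
  have : `|lead_coef p| = 1.
    have := monicP trinomial_monic; rewrite pq lead_coefM => E.
    have : `|lead_coef p| * `|lead_coef q| = 1 by rewrite -normrM E normr1.
    have /norP[p1' q1'] : ~~ ((lead_coef p == 0) || (lead_coef q == 0)).
      by rewrite -mulf_eq0 E.
    move: p1' q1'; rewrite -!normr_gt0 !gtz0_ge1.
    by set u := `|_|; set v := `|_|; nia.
  move=> ->; rewrite ltNge => /negP; apply; rewrite -gtz0_ge1 normr_gt0.
  by apply: contraNneq b_neq0 => p00; rewrite -f0 pq hornerM p00 mul0r.
have [x gx x1] := large _ _ fE g1 g0.
have [y hy y1] := large _ _ (etrans fE (mulrC _ _)) h1 h0.
have Fgh : F = map_poly intr g * map_poly intr h by rewrite fE rmorphM.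
have Fx : root F x by rewrite Fgh rootM gx.
have Fy : root F y by rewrite Fgh rootM hy orbT.
have cof z : root (cofactor x) z -> 1 <= abs z -> False.
  by move=> /(cofactor_root_lt1 _ _ Fx x1); rewrite ltNge => /negP.
have yx : y = x.
  move: Fy; rewrite (trinomial_factor _ Fx) rootM root_XsubC => /orP[/eqP //|].
  by move/cof/(_ y1).
rewrite yx in hy.
have [p Dp] := factor_theorem _ _ gx; have [q Dq] := factor_theorem _ _ hy.
apply: (cof x) => //.
have Xx : 'X - x%:P != 0 :> {poly R[i]} by rewrite polyXsubC_eq0.
have -> : cofactor x = p * q * ('X - x%:P).
  by apply: (mulfI Xx); rewrite -trinomial_factor // Fgh Dp Dq; ring.
by rewrite rootM root_XsubC eqxx orbT.
Qed.

Lemma trinomial_Zirreducible : Zpoly_irreducible f.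
Proof.
split.
- by rewrite -size_poly_gt0 size_trinomial.
- by rewrite poly_unitE size_trinomial.
- move=> g h fE.
  have unit_size1 (p q : {poly int}) : f = p * q -> (size p == 1)%N ->
      p \is a GRing.unit.
    move=> pq /size_poly1P[u u0 pE].
    have := monicP trinomial_monic; rewrite pq pE lead_coefM lead_coefC => uv.
    by rewrite poly_unitE size_polyC u0 coefC eqxx /=; apply/unitrPr; eexists; exact: uv.
  have /orP[sz|sz] := trinomial_no_factor _ _ fE; [left|right].
    exact: unit_size1 fE sz.
  by apply: unit_size1 sz; rewrite mulrC; exact: fE.
Qed.

(** Gauss's lemma: a rational divisor is a scalar multiple of an integral one. *)
Lemma trinomial_Qirreducible : irreducible_poly (map_poly intr f : {poly rat}).
Proof.
split; first by rewrite size_map_inj_poly ?size_trinomial //; exact: intr_inj.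
move=> q q1 /dvdpP_rat_int [g [c c0 qE] [h fE]].
have sz_g : size q = size g.
  by rewrite qE size_scale // size_map_inj_poly //; exact: intr_inj.
have /orP[|/size_poly1P[u u0 hE]] := trinomial_no_factor _ _ fE.
  by rewrite -sz_g (negPf q1).
rewrite qE (eqp_ltrans (eqp_scale _ c0)) fE hE rmorphM /= map_polyC /=.
by rewrite mulrC mul_polyC eqp_sym eqp_scale // intr_eq0.
Qed.

End Perron.

(** * The conjugate lattice *)

(** A nontrivial gcd with the derivative would be associated to [p], but in characteristic zero the
    derivative is nonzero of smaller degree. *)
Lemma irreducible_separable (F : realFieldType) (p : {poly F}) :
  irreducible_poly p -> separable_poly p.
Proof.
move=> [sz_p irr]; rewrite unlock /coprimep; apply/negPn/negP => g1.
have := irr _ g1 (dvdp_gcdl p p^`()); rewrite /eqp => /andP[_ pg].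
have dp : p %| p^`() by apply: dvdp_trans pg (dvdp_gcdr _ _).
have sz_d : size p^`() = (size p).-1 by rewrite size_deriv.
have d0 : p^`() != 0 by rewrite -size_poly_gt0 sz_d -subn1 subn_gt0.
by have := dvdp_leq d0 dp; rewrite sz_d leqNgt prednK ?leqnn // ltnW.
Qed.

(** * Galois action on the roots *)

Section Conjugates.
Variables (R : realType) (K : splittingFieldType rat) (f : {poly int}).
Hypotheses (f_monic : f \is monic)
  (f_irr : irreducible_poly (map_poly intr f : {poly rat})).
Notation fK := (map_poly intr f : {poly K}).
Notation G := ('Gal({:K} / 1))%g.
Hypothesis splitf : is_splitting_field K f.

Lemma fK_in_alg : fK = map_poly (in_alg K) (map_poly intr f : {poly rat}).
Proof.
by rewrite -map_poly_comp; apply: eq_map_poly => z /=; rewrite scaler_int.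
Qed.

Lemma splitting_roots : exists2 s : seq K, uniq s & fK = \prod_(z <- s) ('X - z%:P).
Proof.
have [s fs _] := splitf.
have fE : fK = \prod_(z <- s) ('X - z%:P).
  by apply/eqP; rewrite -eqp_monic ?monic_prod_XsubC // monic_map.
exists s => //; rewrite -separable_prod_XsubC -fE fK_in_alg separable_map.
exact: irreducible_separable.
Qed.

Lemma gal_root (sigma : gal_of {:K}) z : root fK z -> root fK (sigma z).
Proof.
move=> /(rmorph_root sigma); congr (is_true (root _ _)).
by rewrite -map_poly_comp; apply: eq_map_poly => k /=; rewrite rmorph_int.
Qed.

(** The minimal polynomial of [z] comes from a rational divisor of [f], so by irreducibility it is
    associated to [f] and vanishes at [z']; normality then supplies the automorphism. *)
Lemma gal_transitive z z' : root fK z -> root fK z' ->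
  exists2 sigma, sigma \in G & sigma z = z'.
Proof.
move=> fz fz'; apply: normalField_root_minPoly; rewrite ?sub1v ?memvf ?normalFieldf //.
have [q mE] := polyOver1P (minPolyOver 1 z).
have : minPoly 1 z %| fK.
  apply: minPoly_dvdp => //; apply/polyOver1P.
  by exists (map_poly intr f); exact: fK_in_alg.
rewrite mE fK_in_alg dvdp_map => qf.
have /eqp_root -> // : map_poly (in_alg K) q %= fK.
  rewrite fK_in_alg eqp_map; apply: f_irr.2 => //.
  have := size_minPoly 1 z; rewrite mE size_map_poly => ->.
  by rewrite /adjoin_degree.
Qed.

Lemma gal_sum_conj (h : K -> R) z z' : root fK z -> root fK z' ->
  \sum_(sigma in G) h (sigma z) = \sum_(sigma in G) h (sigma z').
Proof.
move=> fz fz'; have [tau Gtau <-] := gal_transitive z z' fz fz'.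
rewrite (reindex_inj (mulgI tau)) /=; apply: eq_big => sigma.
  by rewrite groupMl.
by move=> _; rewrite galM ?memvf.
Qed.

(** Double counting: all roots are sent to [z0] equally often, and each [sigma] sends exactly one
    root there, namely the preimage of [z0]. *)
Lemma gal_count (s : seq K) (z0 z : K) : uniq s -> fK = \prod_(z <- s) ('X - z%:P) ->
  z0 \in s -> z \in s ->
  (size s)%:R * \sum_(sigma in G) (sigma z == z0)%:R = #|G|%:R :> R.
Proof.
move=> us fE z0s zs.
have rs x : x \in s -> root fK x by rewrite fE root_prod_XsubC.
have -> : (size s)%:R * \sum_(sigma in G) (sigma z == z0)%:R =
    \sum_(y <- s) \sum_(sigma in G) (sigma y == z0)%:R :> R.
  rewrite (eq_big_seq (fun=> \sum_(sigma in G) (sigma z == z0)%:R)).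
    by rewrite big_const_seq count_predT iter_addr_0 mulr_natl.
  by move=> y ys; apply: (gal_sum_conj (fun x => (x == z0)%:R)); apply: rs.
rewrite exchange_big /= -sum1_card natr_sum; apply: eq_bigr => sigma Gs.
rewrite (bigD1_seq ((sigma^-1)%g z0)) //=; last first.
  by rewrite -root_prod_XsubC -fE gal_root ?rs.
rewrite -galM ?memvf // mulVg gal_id eqxx big1 ?addr0 // => y /eqP yz.
case: eqP => // E; case: yz.
by rewrite -E -galM ?memvf // mulgV gal_id.
Qed.

End Conjugates.

(** * Inner products of conjugate vectors *)

Section SigmaGram.
Variables (R : realType) (K : splittingFieldType rat) (iota : {rmorphism K -> R[i]}).
Notation abs := (@Normc.normc R).
Notation G := ('Gal({:K} / 1))%g.

Lemma herm_Sigma x y : complex.Re (herm (Sigma iota x) (Sigma iota y)) =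
  \sum_(sigma in G) complex.Re (iota (sigma x) * (iota (sigma y))^*).
Proof.
rewrite /herm Re_sum [RHS]big_enum_val; apply: eq_bigr => k _.
by rewrite !mxE.
Qed.

Lemma Re_mul_conj (u : R[i]) : complex.Re (u * u^*) = abs u ^+ 2.
Proof.
case: u => a b /=; rewrite sqr_sqrtr ?addr_ge0 ?sqr_ge0 //; ring.
Qed.

Lemma Re_mul_conj_le (u v : R[i]) : `|complex.Re (u * v^*)| <= abs u * abs v.
Proof.
have -> : abs v = abs v^*.
  by case: v => a b /=; rewrite sqrrN.
rewrite -Normc.normcM; case: (u * v^*) => a b /=.
by rewrite -sqrtr_sqr ler_sqrt ?lerDl ?addr_ge0 ?sqr_ge0.
Qed.

End SigmaGram.

(** * The lattice of a trinomial *)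

Section TrinomialLattice.
Variables (R : realType) (m : nat) (a b : int).
Hypotheses (m_ge2 : (2 <= m)%N) (ltab : `|b| + 1 < `|a|)
  (b_large : 6 * m%:R <= `|b|%:~R :> R).
Local Notation f := (trinomial m a b).
Variables (K : splittingFieldType rat) (iota : {rmorphism K -> R[i]}).
Hypothesis splitf : is_splitting_field K f.
Notation fK := (map_poly intr f : {poly K}).
Notation abs := (@Normc.normc R).
Notation G := ('Gal({:K} / 1))%g.

Let m_gt0 : (0 < m)%N. Proof. exact: leq_trans m_ge2. Qed.

Let mR : 2 <= m%:R :> R. Proof. by rewrite ler_nat. Qed.

Let b_neq0 : b != 0.
Proof.
by apply/eqP => b0; move: b_large mR; rewrite b0 normr0; lra.
Qed.

Let f_irr : irreducible_poly (map_poly intr f : {poly rat}).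
Proof. exact: (trinomial_Qirreducible R). Qed.

Lemma iota_root z : root fK z -> root (map_poly intr f) (iota z).
Proof.
move=> /(rmorph_root iota); congr (is_true (root _ _)).
by rewrite -map_poly_comp; apply: eq_map_poly => k /=; rewrite rmorph_int.
Qed.

Lemma dominant_conjugate : exists z0, [/\ root fK z0, 6 * m%:R <= abs (iota z0)
  & forall z, root fK z -> z != z0 -> abs (iota z) <= 1].
Proof.
have [th Fth th1] := large_root R m a b b_neq0 m_gt0.
have [s _ fE] := splitting_roots K f (trinomial_monic m a b) f_irr splitf.
(* As [f] splits in [K], the large complex root lies in the image of [iota]. *)
have [z0 z0s thE] : exists2 z, z \in s & th = iota z.
  have FE : map_poly intr f = map_poly iota fK.
    by rewrite -map_poly_comp; apply: eq_map_poly => k /=; rewrite rmorph_int.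
  move: Fth; rewrite FE fE rmorph_prod /=.
  under eq_bigr => z _ do rewrite map_polyXsubC.
  by rewrite -(big_map iota xpredT (fun x => 'X - x%:P)) root_prod_XsubC => /mapP.
exists z0; split; first by rewrite fE root_prod_XsubC.
  rewrite -thE; have := large_root_ge R m a b ltab _ Fth th1.
  set A := abs th in th1 *; set B := `|b|%:~R => AB.
  have B12 : 12 <= B by move: b_large mR; rewrite -/B; lra.
  have X1 : A <= A ^+ m by rewrite -{1}[A]expr1 ler_weXn2l.
  have A0 : 0 < A by lra.
  have A2 : A ^+ 2 <= A ^+ m by apply: ler_weXn2l.
  have X0 : 0 < A ^+ m by lra.
  have BX : B / A ^+ m <= B / A ^+ 2.
    by rewrite ler_pM2l ?lef_pV2 ?posrE ?exprn_gt0 //; lra.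
  (* Bootstrapping: [B / A^2 <= B] gives [A >= 2]; then [B / A^2 <= B / 4] gives [A >= 3/4 B + 2];
     then [B / A^2 <= 2] gives [A >= B]. *)
  have BA1 : B / A ^+ 2 <= B.
    rewrite ler_pdivrMr ?exprn_gt0 // ler_peMr; [done|lra|].
    by rewrite -[1](expr1n _ 2) lerXn2r ?nnegrE // ltW.
  have A_ge2 : 2 <= A by lra.
  have BA2 : B / A ^+ 2 <= B / 4.
    rewrite ler_pM2l ?lef_pV2 ?posrE ?exprn_gt0 //; [nra|lra].
  have BA3 : B / A ^+ 2 <= 2.
    rewrite ler_pdivrMr ?exprn_gt0 //.
    have : 3 / 4 * B + 2 <= A by lra.
    nra.
  by move: b_large; rewrite -/B; lra.
move=> z fz zz0; apply: ltW.
have := iota_root z fz.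
rewrite (trinomial_factor _ _ _ _ _ Fth) rootM root_XsubC thE (inj_eq (fmorph_inj iota)).
rewrite (negPf zz0) -thE; exact: (cofactor_root_lt1 _ _ _ _ ltab).
Qed.

Lemma trinomial_lattice :
  let L := conj_lattice iota f in
  [/\ lattice_of_rank (K_R iota) m.+1 L,
      generic_well_rounded m.+1 L,
      nearly_orthogonal m.+1 L &
      exists v : 'I_m.+1 -> 'rV[R[i]]_#|('Gal({:K} / 1))%g|,
        lattice_basis L v /\ (forall i, min_vectors L (v i))].
Proof.
have [s us fE] := splitting_roots K f (trinomial_monic m a b) f_irr splitf.
have rs x : (x \in s) = root fK x by rewrite fE root_prod_XsubC.
have sz_s : size s = m.+1.
  apply: succn_inj; rewrite -(size_prod_XsubC s id) -fE.
  rewrite size_map_poly_id0 ?size_trinomial //.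
  by rewrite (monicP (trinomial_monic m a b)) oner_eq0.
have [z0 [fz0 A6 small]] := dominant_conjugate; set A := abs (iota z0) in A6.
pose v (i : 'I_m.+1) := Sigma iota s`_i.
have rv (i : 'I_m.+1) : root fK s`_i by rewrite -rs mem_nth ?sz_s.
pose M := \sum_(sigma in G) abs (iota (sigma z0)) ^+ 2.
pose S : R := \sum_(sigma in G) (sigma z0 == z0)%:R.
have f_monic := trinomial_monic m a b.
have dS : m.+1%:R * S = #|G|%:R.
  by rewrite -sz_s; apply: (gal_count R K f) => //; rewrite rs.
have S_gt0 : 0 < S.
  rewrite -(pmulr_rgt0 (x := m.+1%:R)) ?ltr0n // dS ltr0n.
  exact: cardG_gt0.
have SE z : root fK z -> \sum_(sigma in G) (sigma z == z0)%:R = S.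
  by move=> fz; apply: (gal_sum_conj R K f f_irr (fun x => (x == z0)%:R)).
have A12 : 12 <= A by move: A6 mR; lra.
have diagM i : complex.Re (herm (v i) (v i)) = M.
  rewrite herm_Sigma.
  under eq_bigr => sigma _ do rewrite Re_mul_conj.
  exact: (gal_sum_conj R K f f_irr (fun x => abs (iota x) ^+ 2)).
have MS : A ^+ 2 * S <= M.
  rewrite mulr_sumr; apply: ler_sum => sigma _.
  case: eqP => [->|_]; first by rewrite mulr1.
  by rewrite mulr0 sqr_ge0.
(* The ratio of the off-diagonal bound [S (m - 1 + 2 A)] to the lower bound [A^2 S] for [M]. *)
pose eps := (m%:R - 1 + 2 * A) / A ^+ 2.
have A2_gt0 : 0 < A ^+ 2 by rewrite exprn_gt0 //; lra.
have eps_ge0 : 0 <= eps by rewrite divr_ge0 ?(ltW A2_gt0) //; move: mR; lra.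
have bound z : root fK z -> abs (iota z) <= 1 + (A - 1) * (z == z0)%:R.
  move=> fz; have [->|zz0] := eqVneq z z0; first by rewrite mulr1 addrC subrK.
  by rewrite mulr0 addr0 small.
have offdiag i j : i != j -> `|complex.Re (herm (v i) (v j))| <= eps * M.
  move=> ij; apply: (@le_trans _ _ (S * (m%:R - 1 + 2 * A))); last first.
    apply: le_trans (ler_wpM2l eps_ge0 MS).
    by rewrite mulrA /eps divfK ?lt0r_neq0 // mulrC.
  rewrite herm_Sigma; apply: le_trans (ler_norm_sum _ _ _) _.
  (* Distinct roots are not both sent to [z0], so each term is at most [A], or 1 if neither is. The
     sum is [(m + 1) S + 2 (A - 1) S]. *)
  apply: (@le_trans _ _ (\sum_(sigma in G) (1 + (A - 1) *
      ((sigma s`_i == z0)%:R + (sigma s`_j == z0)%:R)))).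
    apply: ler_sum => sigma _; apply: le_trans (Re_mul_conj_le _ _ _) _.
    have := bound _ (gal_root K f sigma _ (rv i)).
    have := bound _ (gal_root K f sigma _ (rv j)).
    have := abs_ge0 R (iota (sigma s`_i)); have := abs_ge0 R (iota (sigma s`_j)).
    have : ~~ ((sigma s`_i == z0) && (sigma s`_j == z0)).
      apply: contra ij => /andP[/eqP <- /eqP /fmorph_inj E].
      by apply/eqP/val_inj/eqP; rewrite -(nth_uniq 0 _ _ us) ?sz_s //= E.
    set x := abs _; set y := abs _.
    case: (_ == z0); case: (_ == z0) => //= _; nra.
  rewrite big_split /= -mulr_sumr big_split /= !SE // sumr_const -dS.
  rewrite -natr1; lra.
have M_gt0 : 0 < M by apply: lt_le_trans MS; apply: mulr_gt0.
(* From [A >= 6 m]: [m (m - 1) <= A^2 / 36] and [2 m A <= A^2 / 3], which total [13/36 A^2], below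
   [3/8 A^2]. *)
have eps_small : (m.+1%:R - 1) * eps <= 3 / 8.
  rewrite -natr1 addrK /eps mulrA ler_pdivrMr //.
  move: mR A6; set q := m%:R => q2 A6; nra.
have LE : conj_lattice iota f = int_span (range v).
  rewrite /conj_lattice; congr int_span; apply/seteqP; split => w /=.
    move=> [z fz <-]; have zs : z \in s by rewrite rs.
    have zi : (index z s < m.+1)%N by rewrite -sz_s index_mem.
    by exists (Ordinal zi) => //; rewrite /v /= nth_index.
  by move=> [i _ <-]; exists s`_i => //; exact: rv.
have m3 : (3 <= m.+1)%N by [].
have basis : lattice_basis (int_span (range v)) v.
  exact: (lattice_basis_b _ _ _ _ M eps M_gt0 eps_small diagM offdiag).
rewrite /= LE; split.
- split; last by exists v.
  move=> w /int_span_comb[k ->].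
  by exists m.+1, (fun i => (k i)%:~R), v; split => // i; exists s`_i.
- exact: (generic_well_rounded_b _ _ _ _ M eps m3 M_gt0 eps_small diagM offdiag).
- exists v; split => //.
  exact: (nearly_orthogonal_b _ _ _ _ M eps m3 M_gt0 eps_ge0 eps_small diagM offdiag).
- exists v; split => // i.
  exact: (min_b _ _ _ _ M eps m3 M_gt0 eps_small diagM offdiag).
Qed.

End TrinomialLattice.

(** * Explicit families of polynomials *)

Lemma trinomial_GWR (R : realType) (m : nat) (a b : int) : (2 <= m)%N ->
  `|b| + 1 < `|a| -> 6 * m%:R <= `|b|%:~R :> R ->
  GWR_nearly_orthogonal_poly R m.+1 (trinomial m a b).
Proof.
move=> m2 ltab b_large.
have b0 : b != 0.
  apply/eqP => b0; move: b_large; rewrite b0 normr0.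
  have : 2 <= m%:R :> R by rewrite ler_nat.
  lra.
split; first exact: size_trinomial.
  by apply: (trinomial_Zirreducible R) => //; exact: leq_trans m2.
by move=> K iota splitf; exact: trinomial_lattice.
Qed.

Theorem theorem1p5 (R : realType) (n : nat) (n_ge3 : (3 <= n)%N)
    (n_prime : prime n) :
  infinite_set [set f : {poly int} | GWR_nearly_orthogonal_poly R n f] /\
  (forall a0 an1 : int,
     8 * (n%:R - 1) * (n`!)%:R
       / (Num.sqrt ((n%:R - 2) ^+ 2 + 16 * (n%:R - 1)) - (n%:R - 2))
       < `|a0|%:~R :> R ->
     `|a0| + 1 < `|an1| ->
     GWR_nearly_orthogonal_poly R n
       ('X^n + an1%:P * 'X^(n.-1) + a0%:P)).
Proof.
case: n n_ge3 n_prime => // m m2 _; rewrite ltnS in m2.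
split.
  pose N : int := (6 * m)%N.
  (* The constant term is fixed at [6 m]; the coefficient of [X^m] varies and tells the members
     apart. *)
  pose p k := trinomial m (N + 2 + k%:Z) N.
  have p_inj : injective p.
    move=> k l /(congr1 (fun q : {poly int} => q`_m)).
    rewrite !(coefD, coefCM, coefXn, coefC) eqxx mulr1.
    by move=> /addIr /addrI; rewrite mulr1 => /addrI [].
  have pP k : [set f | GWR_nearly_orthogonal_poly R m.+1 f] (p k).
    apply: trinomial_GWR => //; first by rewrite /N; lia.
    by rewrite ger0_norm // -natrM; exact: lexx.
  have sub : p @` [set: nat] `<=` [set f | GWR_nearly_orthogonal_poly R m.+1 f].
    by move=> _ [k _ <-]; exact: pP.
  move=> /(sub_finite_set sub); rewrite (eq_finite_set (inj_card_eq (in2W p_inj))).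
  exact: infinite_nat.
(* With [n = m + 1], the bounds [0 < D <= 8] and [n! >= 6] give [8 m n! / D >= 6 m]. *)
move=> a b; set D := Num.sqrt _ - _ => blt ltab.
apply: trinomial_GWR => //.
have mR : 2 <= m%:R :> R by rewrite ler_nat.
have nE : m.+1%:R = m%:R + 1 :> R by rewrite natr1.
have fact6 : 6 <= (m.+1)`!%:R :> R.
  by rewrite (ler_nat _ 6); apply: (@leq_trans 3`!) => //; exact: leq_fact.
have sq : 0 <= (m.+1%:R - 2) ^+ 2 + 16 * (m.+1%:R - 1) :> R.
  by rewrite addr_ge0 ?sqr_ge0 // nE; lra.
have D_gt0 : 0 < D.
  rewrite subr_gt0 -[ltLHS]ger0_norm; last by rewrite nE; lra.
  by rewrite -sqrtr_sqr ltr_sqrt ?ltrDl nE; nra.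
(* The radicand is [m^2 + 14 m + 1], at most [(m + 7)^2], and [n - 2 = m - 1]. *)
have D_le8 : D <= 8.
  rewrite lerBlDl -[leRHS]ger0_norm; last by rewrite nE; lra.
  by rewrite -sqrtr_sqr ler_sqrt ?sqr_ge0 // nE; nra.
apply: le_trans (ltW blt); rewrite ler_pdivlMr //.
rewrite nE addrK; have : m%:R * 6 <= m%:R * (m.+1)`!%:R :> R by rewrite ler_wpM2l.
have : 6 * m%:R * D <= 6 * m%:R * 8 by rewrite ler_wpM2l //; lra.
lra.
Qed.
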